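(* The map $\mathcal{H}^{\mathrm{inv}}\to\mathcal{H}^{e}$ given by $$b_n\mapsto t_n:=\sum_{|t|=n}t\qquad(n\ge1),$$ and extended as a homomorphism of unital algebras, is an injective co-algebra homomorphism. In particular, the Hopf algebra $\mathcal{H}^{\mathrm{inv}}$ is a Hopf sub-algebra of $\mathcal{H}^{e}$. The same is true if $\mathcal{H}^{e}$ is replaced by $\mathcal{H}^{\gamma}$ in these statements.
   Context: $\mathcal{H}^{\mathrm{inv}}=\mathbb{C}\langle b_1,b_2,\dots\rangle$ is the free associative unital $\mathbb{C}$-algebra on variables $b_n$, $n\ge1$, with $b_0:=1$, and with co-product the algebra homomorphism $\Delta^{\mathrm{inv}}:\mathcal{H}^{\mathrm{inv}}\to\mathcal{H}^{\mathrm{inv}}\otimes\mathcal{H}^{\mathrm{inv}}$ given by $\Delta^{\mathrm{inv}}b_n=\sum_{k=0}^nb_k\otimes b_{n-k}$ and co-unit $\varepsilon(b_n)=0$ for $n\ge1$; it is a Hopf algebra. Let $Y_n$ be the set of rooted planar binary trees with $n$ internal vertices, $Y_\infty=\bigcup_{n\ge0}Y_n$, and $|t|$ the number of internal vertices of $t$. The unique element of $Y_0$ (the root tree) is denoted $|$. For trees $r,s$, $r\vee s$ is the tree obtained by grafting $r$ (left) and $s$ (right) on a new root. As algebras, $\mathcal{H}^{e}$ and $\mathcal{H}^{\gamma}$ are both the free associative algebra $\mathbb{C}\langle Y_\infty\rangle/(|-1)$ on the set of all trees, with the root tree $|$ identified with the unit $1$. Their co-products, $\Delta^p_e$ on $\mathcal{H}^{e}$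 and $\Delta^p_\gamma$ on $\mathcal{H}^{\gamma}$, are the algebra homomorphisms given on the generators recursively by $\Delta^p_e(|)=\Delta^p_\gamma(|)=1\otimes1$ and $$\Delta^p_e(r\vee s)=1\otimes(r\vee s)+\sum(r\vee s_{(1)})\otimes s_{(2)},\qquad \textstyle\sum s_{(1)}\otimes s_{(2)}=\Delta^p_e(s),$$ $$\Delta^p_\gamma(r\vee s)=(r\vee s)\otimes1+\sum r_{(1)}\otimes(r_{(2)}\vee s),\qquad \textstyle\sum r_{(1)}\otimes r_{(2)}=\Delta^p_\gamma(r),$$ where $1$ inside $\vee$ means the root tree. Equivalently, on trees they are the duals of the under product $t\backslash s$ (grafting the root of $s$ on the right-most leaf of $t$), respectively the over product $t/s$ (grafting the root of $t$ on the left-most leaf of $s$). The co-units send all trees other than $|$ to $0$. With these structures $\mathcal{H}^{e}$ and $\mathcal{H}^{\gamma}$ are Hopf algebras. *)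

(* Defs.v *)
From HB Require Import structures.
From mathcomp Require Import all_boot all_order all_algebra.
From mathcomp Require Import finmap monalg.

Set Implicit Arguments.
Unset Strict Implicit.
Unset Printing Implicit Defensive.

Import GRing.Theory.
Local Open Scope ring_scope.

(******************************************************************************)
(* All algebras are monoid algebras K[M] = {malg K[M]}. The tensor product    *)
(* K[M] (x) K[N] is realised as K[M * N], the basis vector of (m, n) being    *)
(* m (x) n; its product is the usual (a (x) b) (c (x) d) = ac (x) bd (tensM). *)
(******************************************************************************)

Section ProdMonom.
Variables M N : monomType.
Implicit Types p q : (M * N)%type.

Definition pair_mone : M * N := (mone, mone).
Definition pair_mmul p q : M * N := (mmul p.1 q.1, mmul p.2 q.2).

Fact pair_mmulA : associative pair_mmul.
Proof. by move=> p q r; rewrite /pair_mmul /= !mulmA. Qed.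
Fact pair_mul1m : left_id pair_mone pair_mmul.
Proof. by case=> x y; rewrite /pair_mmul /= !mul1m. Qed.
Fact pair_mulm1 : right_id pair_mone pair_mmul.
Proof. by case=> x y; rewrite /pair_mmul /= !mulm1. Qed.
Fact pair_unitm p q :
  pair_mmul p q = pair_mone -> p = pair_mone /\ q = pair_mone.
Proof.
by case: p q => [x y] [x' y'] [] /unitm[-> ->] /unitm[-> ->].
Qed.

HB.instance Definition _ := Choice_isMonomialDef.Build (M * N)%type
  pair_mmulA pair_mul1m pair_mulm1 pair_unitm.
End ProdMonom.

Section MalgAlgebra.
Variables (K : comNzRingType) (M : monomType).

Lemma malgUZ (c : K) (m : M) : << c *g m >> = c *: << m >>.
Proof. by apply/malgP => k; rewrite mcoeffZ !mcoeffU mulrnAr mulr1. Qed.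

Lemma malg_scaleAr (c : K) (u v : {malg K[M]}) : c *: (u * v) = u * (c *: v).
Proof.
apply/malgP => k; rewrite mcoeffZ mcoeffMl.
rewrite (mcoeffMlw k (fsubset_refl (msupp u)) (msuppZ_le c v)) mulr_sumr.
apply: eq_bigr => m _; rewrite mulr_sumr; apply: eq_bigr => n _.
by rewrite mcoeffZ mulrnAr mulrCA.
Qed.
End MalgAlgebra.

Definition algebra_morphism (K : comNzRingType) (A B : lalgType K)
  (f : A -> B) : Prop := linear f /\ monoid_morphism f.

Section LinearExtension.
Variables (K : comNzRingType) (M : choiceType) (V : lmodType K) (h : M -> V).

Definition linext (u : {malg K[M]}) : V := \sum_(m <- msupp u) u@_m *: h m.

Lemma linextEw (d : {fset M}) u :
  (msupp u `<=` d)%fset -> linext u = \sum_(m <- d) u@_m *: h m.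
Proof.
move=> le; rewrite /linext (big_fset_incl _ le) // => m _ /mcoeff_outdom ->.
by rewrite scale0r.
Qed.

Fact linext_is_linear : linear linext.
Proof.
move=> c u v; pose d := (msupp u `|` msupp v)%fset.
rewrite !(@linextEw d) ?fsubsetUl ?fsubsetUr //; last first.
  apply: fsubset_trans (msuppD_le _ _) _.
  exact: fsetSU (msuppZ_le _ _).
rewrite scaler_sumr -big_split; apply: eq_bigr => m _ /=.
by rewrite mcoeffD mcoeffZ scalerDl scalerA.
Qed.

HB.instance Definition _ :=
  GRing.isLinear.Build K {malg K[M]} V *:%R linext linext_is_linear.

Lemma linextU m : linext << m >> = h m.
Proof.
rewrite (@linextEw [fset m]%fset) ?msuppU_le // big_seq_fset1.
by rewrite mcoeffUU scale1r.
Qed.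
End LinearExtension.

Section Tensor.
Variable K : comNzRingType.

Definition tens (M N : monomType) (u : {malg K[M]}) (v : {malg K[N]}) :
    {malg K[(M * N)%type]} :=
  \sum_(m <- msupp u) \sum_(n <- msupp v) << u@_m * v@_n *g (m, n) >>.

(* the linear map on K[M] (x) K[N] induced by a bilinear map B *)
Definition tlift (M N : monomType) (V : lmodType K)
    (B : {malg K[M]} -> {malg K[N]} -> V) : {malg K[(M * N)%type]} -> V :=
  linext (fun p => B << p.1 >> << p.2 >>).

(* f (x) g, for linear f and g *)
Definition tmap (M M' N N' : monomType) (f : {malg K[M]} -> {malg K[M']})
    (g : {malg K[N]} -> {malg K[N']}) : {malg K[(M * N)%type]} -> {malg K[(M' * N')%type]} :=
  tlift (fun a b => tens (f a) (g b)).

Definition tassoc (M N P : monomType) :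
    {malg K[((M * N) * P)%type]} -> {malg K[(M * (N * P))%type]} :=
  linext (fun p => << (p.1.1, (p.1.2, p.2)) >>).

Section TensTheory.
Variables M N : monomType.
Implicit Types (u : {malg K[M]}) (v : {malg K[N]}).

Lemma tensE u v : tens u v = linext (fun m => linext (fun n => << (m, n) >>) v) u.
Proof.
apply: eq_bigr => m _; rewrite scaler_sumr; apply: eq_bigr => n _.
by rewrite scalerA malgUZ.
Qed.

Lemma mcoeff_tens u v p : (tens u v)@_p = u@_p.1 * v@_p.2.
Proof.
pose d := (p.1 |` msupp u)%fset; pose e := (p.2 |` msupp v)%fset.
rewrite tensE (@linextEw _ _ _ _ d) ?fsubsetUr // raddf_sum /=.
rewrite (big_fsetD1 p.1) ?fset1U1 //= big1_fset ?addr0 => [|m].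
  rewrite mcoeffZ (@linextEw _ _ _ _ e) ?fsubsetUr // raddf_sum /=.
  rewrite (big_fsetD1 p.2) ?fset1U1 //= big1_fset ?addr0 => [|n].
    by rewrite mcoeffZ mcoeffU -surjective_pairing eqxx mulr1.
  rewrite in_fsetD1 => /andP[ne_n _] _; rewrite mcoeffZ mcoeffU -pair_eqE /=.
  by rewrite (negPf ne_n) andbF mulr0.
rewrite in_fsetD1 => /andP[ne_m _] _; rewrite mcoeffZ raddf_sum big1 ?mulr0 //.
move=> n _; rewrite /= mcoeffZ mcoeffU -pair_eqE /= (negPf ne_m) mulr0.
by [].
Qed.

Lemma tensU (m : M) (n : N) : tens << m >> << n >> = << (m, n) >>.
Proof.
apply/malgP => p; rewrite mcoeff_tens !mcoeffU -pair_eqE /=.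
by rewrite -natrM mulnb.
Qed.

Lemma tensDl u u' v : tens (u + u') v = tens u v + tens u' v.
Proof. by apply/malgP => p; rewrite mcoeffD !mcoeff_tens mcoeffD mulrDl. Qed.

Lemma tensDr u v v' : tens u (v + v') = tens u v + tens u v'.
Proof. by apply/malgP => p; rewrite mcoeffD !mcoeff_tens mcoeffD mulrDr. Qed.

Lemma tensZl c u v : tens (c *: u) v = c *: tens u v.
Proof. by apply/malgP => p; rewrite mcoeffZ !mcoeff_tens mcoeffZ mulrA. Qed.

Lemma tensZr c u v : tens u (c *: v) = c *: tens u v.
Proof. by apply/malgP => p; rewrite mcoeffZ !mcoeff_tens mcoeffZ mulrCA. Qed.

Lemma tensM u u' v v' : tens u v * tens u' v' = tens (u * u') (v * v').
Proof.
have expand (P : monomType) (F : {malg K[P]} -> {malg K[(M * N)%type]}) :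
    (forall x y, F (x + y) = F x + F y) -> (forall c x, F (c *: x) = c *: F x) ->
    forall x, F x = \sum_(k <- msupp x) x@_k *: F << k >>.
  move=> FD FZ x; have F0 : F 0 = 0 by rewrite -[0](scale0r 0) FZ scale0r.
  rewrite {1}[x]monalgE (big_morph F FD F0); apply: eq_bigr => k _.
  by rewrite -FZ -malgUZ.
rewrite (expand _ (fun x => tens x v * _)); last 2 first.
- by move=> x y; rewrite tensDl mulrDl.
- by move=> c x; rewrite tensZl scalerAl.
rewrite [RHS](expand _ (fun x => tens (x * _) _)); last 2 first.
- by move=> x y; rewrite mulrDl tensDl.
- by move=> c x; rewrite -scalerAl tensZl.
apply: eq_bigr => m _; congr (_ *: _).
rewrite (expand _ (fun x => tens _ x * _)); last 2 first.
- by move=> x y; rewrite tensDr mulrDl.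
- by move=> c x; rewrite tensZr scalerAl.
rewrite [RHS](expand _ (fun x => tens _ (x * _))); last 2 first.
- by move=> x y; rewrite mulrDl tensDr.
- by move=> c x; rewrite -scalerAl tensZr.
apply: eq_bigr => n _; congr (_ *: _).
rewrite (expand _ (fun x => _ * tens x _)); last 2 first.
- by move=> x y; rewrite tensDl mulrDr.
- by move=> c x; rewrite tensZl malg_scaleAr.
rewrite [RHS](expand _ (fun x => tens (_ * x) _)); last 2 first.
- by move=> x y; rewrite mulrDr tensDl.
- by move=> c x; rewrite -malg_scaleAr tensZl.
apply: eq_bigr => m' _; congr (_ *: _).
rewrite (expand _ (fun x => _ * tens _ x)); last 2 first.
- by move=> x y; rewrite tensDr mulrDr.
- by move=> c x; rewrite tensZr malg_scaleAr.
rewrite [RHS](expand _ (fun x => tens _ (_ * x))); last 2 first.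
- by move=> x y; rewrite mulrDr tensDr.
- by move=> c x; rewrite -malg_scaleAr tensZr.
apply: eq_bigr => n' _; congr (_ *: _).
by rewrite !tensU !malgM_def !fgmulUU !mulr1 tensU.
Qed.
End TensTheory.

Lemma tlift_tens (M N : monomType) (V : lmodType K)
    (B : {malg K[M]} -> {malg K[N]} -> V) :
    (forall v, linear (B^~ v)) -> (forall u, linear (B u)) ->
  forall u v, tlift B (tens u v) = B u v.
Proof.
move=> linl linr u v.
pose Bl w := GRing.isLinear.Build K _ _ _ (B^~ w) (linl w).
pose Br w := GRing.isLinear.Build K _ _ _ (B w) (linr w).
pose BL w : {linear _ -> _} := HB.pack (B^~ w) (Bl w).
pose BR w : {linear _ -> _} := HB.pack (B w) (Br w).
have expU (P : monomType) (x : {malg K[P]}) :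
    x = \sum_(k <- msupp x) x@_k *: << k >>.
  by rewrite [LHS]monalgE; apply: eq_bigr => k _; rewrite malgUZ.
rewrite /tlift tensE [X in linext _ X]/linext linear_sum.
rewrite [in RHS](expU _ u) -[RHS]/(BL v _) linear_sum.
apply: eq_bigr => m _; rewrite !linearZ /=; congr (_ *: _).
rewrite [in RHS](expU _ v) -[RHS]/(BR _ _) linear_sum linear_sum.
by apply: eq_bigr => n _; rewrite !linearZ /= linextU.
Qed.
End Tensor.

(******************************************************************************)
(* K<X>/(x0 - 1), the free algebra on X with the letter x0 identified with 1, *)
(* is realised as the free algebra on the letters other than x0; gen x is the *)
(* class of the letter x, so that gen x0 = 1.                                 *)
(******************************************************************************)

Section FreeAlgebra.
Variables (K : comNzRingType) (X : choiceType) (x0 : X).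

Definition letter := {x : X | x != x0}.

Definition gen (x : X) : {malg K[{fmonom letter}]} :=
  if insub x is Some y then << fmu y >> else 1.

Lemma gen0 : gen x0 = 1.
Proof. by rewrite /gen insubF // eqxx. Qed.

Lemma genE (x : X) (ne : x != x0) : gen x = << fmu (Sub x ne : letter) >>.
Proof. by rewrite /gen insubT. Qed.

(* the morphism of unital algebras mapping gen x to f x for all x != x0; the  *)
(* value f x0 is ignored, gen x0 = 1 being mapped to 1                        *)
Section Lift.
Variables (A : lalgType K) (f : X -> A).

Definition free_lift : {malg K[{fmonom letter}]} -> A :=
  linext (fun w : {fmonom letter} => \prod_(y <- (w : seq letter)) f (val y)).

Lemma free_lift_gen x : x != x0 -> free_lift (gen x) = f x.
Proof. by move=> ne; rewrite genE /free_lift linextU fmU big_seq1. Qed.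

Lemma free_lift_algebra_morphism :
    (forall (c : K) (a b : A), c *: (a * b) = a * (c *: b)) ->
  algebra_morphism free_lift.
Proof.
move=> scaleAr; split; first exact: linext_is_linear.
have free_liftU w : free_lift << w >> = \prod_(y <- (w : seq letter)) f (val y).
  exact: linextU.
split=> [|u v]; first by rewrite free_liftU fm1 big_nil.
rewrite malgME [free_lift u]/free_lift /linext mulr_suml [LHS]linear_sum /=.
apply: eq_bigr => m _; rewrite mulr_sumr [LHS]linear_sum /=.
apply: eq_bigr => n _; rewrite malgUZ linearZ /= -/free_lift free_liftU.
rewrite -scalerAl -scaleAr scalerA; congr (_ *: _).
by rewrite -big_cat -fmM.
Qed.
End Lift.
End FreeAlgebra.

Section Hopf.
Variable K : comNzRingType.

Record costructure (M : monomType) := Costructure {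
  comul : {malg K[M]} -> {malg K[(M * M)%type]};
  counit : {malg K[M]} -> K^o
}.

Definition is_coalgebra (M : monomType) (H : costructure M) : Prop :=
  [/\ linear (comul H), linear (counit H),
      forall x, tassoc (tmap (comul H) id (comul H x))
                = tmap id (comul H) (comul H x),
      forall x, tlift (fun a b => (counit H a : K) *: b) (comul H x) = x
    & forall x, tlift (fun a b => (counit H b : K) *: a) (comul H x) = x].

Definition is_bialgebra (M : monomType) (H : costructure M) : Prop :=
  [/\ is_coalgebra H, algebra_morphism (comul H)
    & algebra_morphism (counit H)].

Definition convolution (M : monomType) (H : costructure M)
    (f g : {malg K[M]} -> {malg K[M]}) (x : {malg K[M]}) : {malg K[M]} :=
  tlift (fun a b => f a * g b) (comul H x).

Definition is_antipode (M : monomType) (H : costructure M)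
    (S : {malg K[M]} -> {malg K[M]}) : Prop :=
  [/\ linear S,
      forall x, convolution H S id x = (counit H x : K) *: 1
    & forall x, convolution H id S x = (counit H x : K) *: 1].

Definition is_hopf_algebra (M : monomType) (H : costructure M)
    (S : {malg K[M]} -> {malg K[M]}) : Prop :=
  is_bialgebra H /\ is_antipode H S.

Definition coalgebra_morphism (M N : monomType)
    (H : costructure M) (H' : costructure N)
    (f : {malg K[M]} -> {malg K[N]}) : Prop :=
  [/\ linear f, forall x, comul H' (f x) = tmap f f (comul H x)
    & forall x, counit H' (f x) = counit H x].

Definition hopf_morphism (M N : monomType)
    (H : costructure M) (S : {malg K[M]} -> {malg K[M]})
    (H' : costructure N) (S' : {malg K[N]} -> {malg K[N]})
    (f : {malg K[M]} -> {malg K[N]}) : Prop :=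
  [/\ algebra_morphism f, coalgebra_morphism H H' f
    & forall x, f (S x) = S' (f x)].

Definition in_tensor_square (M : monomType) (P : {malg K[M]} -> Prop)
    (z : {malg K[(M * M)%type]}) : Prop :=
  exists s : seq ({malg K[M]} * {malg K[M]}),
    (forall p, p \in s -> P p.1 /\ P p.2)
    /\ z = \sum_(p <- s) tens p.1 p.2.

Definition hopf_subalgebra (M : monomType) (H : costructure M)
    (S : {malg K[M]} -> {malg K[M]}) (P : {malg K[M]} -> Prop) : Prop :=
  [/\ P 1 /\ (forall x y, P x -> P y -> P (x * y)),
      forall c x y, P x -> P y -> P (c *: x + y),
      forall x, P x -> in_tensor_square P (comul H x)
    & forall x, P x -> P (S x)].

(* (H, S) is a Hopf sub-algebra of (H', S') by means of the injection f; the  *)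
(* antipodes are existentially quantified as they are determined by H and H'  *)
Definition hopf_subalgebra_via (M N : monomType)
    (H : costructure M) (H' : costructure N)
    (f : {malg K[M]} -> {malg K[N]}) : Prop :=
  exists S S',
    [/\ is_hopf_algebra H S, is_hopf_algebra H' S',
        injective f /\ hopf_morphism H S H' S' f
      & hopf_subalgebra H' S' (fun y => exists x, y = f x)].
End Hopf.

Section Hinv.
Variable K : comNzRingType.

Definition Inv : monomType := {fmonom (letter 0%N)}.

(* b 0 = 1 *)
Definition b (n : nat) : {malg K[Inv]} := gen K 0%N n.

Definition Hinv : costructure K Inv := {|
  comul := free_lift (fun n =>
    \sum_(k < n.+1) tens (b k) (b (n - k)) : {malg K[(Inv * Inv)%type]});
  counit := free_lift (fun=> 0 : K^o)
|}.
End Hinv.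

(* node r s is the grafting of r (left) and s (right) on a new root; leaf is  *)
(* the root tree, without internal vertex                                     *)
Inductive pbtree := leaf | node (r s : pbtree).

Fixpoint pbtree_code (t : pbtree) : GenTree.tree unit :=
  if t is node r s then GenTree.Node 0 [:: pbtree_code r; pbtree_code s]
  else GenTree.Leaf tt.
Fixpoint pbtree_decode (c : GenTree.tree unit) : pbtree :=
  if c is GenTree.Node _ [:: r; s] then node (pbtree_decode r) (pbtree_decode s)
  else leaf.
Fact pbtree_codeK : cancel pbtree_code pbtree_decode.
Proof. by elim=> //= r -> s ->. Qed.

HB.instance Definition _ := Countable.copy pbtree (can_type pbtree_codeK).

Fixpoint internal (t : pbtree) : nat :=
  if t is node r s then (internal r + internal s).+1 else 0.

Fixpoint height_le (h : nat) : seq pbtree :=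
  if h is h'.+1
  then leaf :: [seq node r s | r <- height_le h', s <- height_le h']
  else [:: leaf].

(* a tree with n internal vertices has height at most n, see mem_Y *)
Definition Y (n : nat) : seq pbtree := [seq t <- height_le n | internal t == n].

Lemma mem_Y n t : (t \in Y n) = (internal t == n).
Proof.
rewrite mem_filter; case: eqP => //= <-.
have: (internal t <= internal t)%N by [].
elim: t {2 3}(internal t) => [|r IHr s IHs] [|h] //= le_h.
rewrite inE; apply/orP; right; apply/allpairsP; exists (r, s).
by split=> //=; [apply: IHr | apply: IHs];
  rewrite (leq_trans _ (le_h : (internal r + internal s <= h)%N)) //;
  rewrite ?leq_addr ?leq_addl.
Qed.

Lemma uniq_Y n : uniq (Y n).
Proof.
apply: filter_uniq; elim: n => //= h IH; apply/andP; split.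
  by apply/allpairsP; case=> -[r s] [].
by apply: allpairs_uniq => // -[r s] [r' s'] _ _ [-> ->].
Qed.

(* The terms of the recursive co-products, all of coefficient 1, as lists of  *)
(* pairs of trees                                                             *)
Fixpoint cuts_e (t : pbtree) : seq (pbtree * pbtree) :=
  if t is node r s
  then (leaf, t) :: [seq (node r p.1, p.2) | p <- cuts_e s]
  else [:: (leaf, leaf)].

Fixpoint cuts_gamma (t : pbtree) : seq (pbtree * pbtree) :=
  if t is node r s
  then (t, leaf) :: [seq (p.1, node p.2 s) | p <- cuts_gamma r]
  else [:: (leaf, leaf)].

Section Htree.
Variable K : comNzRingType.

Definition Tree : monomType := {fmonom (letter leaf)}.

(* tree leaf = 1 *)
Definition tree (t : pbtree) : {malg K[Tree]} := gen K leaf t.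

Definition He : costructure K Tree := {|
  comul := free_lift (fun t =>
    \sum_(p <- cuts_e t) tens (tree p.1) (tree p.2) : {malg K[(Tree * Tree)%type]});
  counit := free_lift (fun=> 0 : K^o)
|}.

Definition Hgamma : costructure K Tree := {|
  comul := free_lift (fun t =>
    \sum_(p <- cuts_gamma t) tens (tree p.1) (tree p.2) :
      {malg K[(Tree * Tree)%type]});
  counit := free_lift (fun=> 0 : K^o)
|}.

Definition tree_sum (n : nat) : {malg K[Tree]} := \sum_(t <- Y n) tree t.

Definition tree_map : {malg K[Inv]} -> {malg K[Tree]} := free_lift tree_sum.

Lemma tree_map_algebra_morphism : algebra_morphism tree_map.
Proof. by apply: free_lift_algebra_morphism; apply: malg_scaleAr. Qed.

Lemma tree_map_b n : tree_map (b K n) = tree_sum n.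
Proof.
case: n => [|n]; last exact: free_lift_gen.
have [_ [map1 _]] := tree_map_algebra_morphism.
by rewrite /b gen0 map1 /tree_sum big_seq1 /tree gen0.
Qed.
End Htree.

(* Main.v *)
Require Import Defs.
From HB Require Import structures.
From mathcomp Require Import all_boot all_order all_algebra.
From mathcomp Require Import boolp.
From mathcomp Require Import finmap monalg reals complex.

Set Implicit Arguments.
Unset Strict Implicit.
Unset Printing Implicit Defensive.

(** Both tree Hopf algebras, and the source as well, are instances of one
    construction. Let X be a graded monoid in which every element has finitely
    many factorisations and whose only element of degree 0 is the unit. The
    free algebra on X, with the unit of X identified with 1, becomes a
    bialgebra when the co-product of a letter is the sum of its factorisations
    into two factors, each read as a tensor of two letters. Binary trees under
    the under product, binary trees under the over product, and the natural
    numbers under addition give the three bialgebras of the statement.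

    Co-associativity and the co-unit laws on letters are the associativity and
    unit laws of X (cuts_sumA, cuts_sum_unitl, cuts_sum_unitr); they extend to
    all elements because both sides are algebra morphisms (free_ext). The
    co-product of a letter only involves tensors of letters, so the convolution
    product restricts to functions on X, where an inverse of the inclusion of
    letters exists by recursion on the degree (conv_inv_left, conv_inv_right).
    Its extension as an anti-morphism is the antipode (cut_antipode): the
    antipode identity is stable under products (convolution_leftM,
    convolution_rightM).

    The degree is a monoid morphism from X to the natural numbers. Dually,
    sending n to the sum of the elements of degree n is compatible with the
    co-products: factorising the elements of degree n, or multiplying elements
    of degrees k and n - k for all k, enumerates the same pairs
    (cuts_sum_fibre). Antipodes correspond by uniqueness of convolution
    inverses (fibre_map_antipode). If every degree is attained, the map is
    injective: choosing one element in each degree and killing all the others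
    gives a morphism that retracts it (fibre_map_inj). *)

Import GRing.Theory.
Local Open Scope ring_scope.

(** * Linear and multiplicative maps on monoid algebras *)

Section LinearMaps.
Variables (K : comNzRingType) (U V : lmodType K) (f : U -> V).
Hypothesis lin : linear f.

(** Linearity is here a property of a plain function; this lemma and the next
    one transfer the theory of bundled linear maps to it. *)
Lemma linear_fun_sum I (r : seq I) (F : I -> U) :
  f (\sum_(i <- r) F i) = \sum_(i <- r) f (F i).
Proof.
pose Lf : {linear U -> V} := HB.pack f (GRing.isLinear.Build K U V *:%R f lin).
exact: (linear_sum Lf).
Qed.

Lemma linear_funZ c u : f (c *: u) = c *: f u.
Proof.
pose Lf : {linear U -> V} := HB.pack f (GRing.isLinear.Build K U V *:%R f lin).
exact: (linearZ_LR Lf).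
Qed.
End LinearMaps.

Section MonoidAlgebra.
Variables (K : comNzRingType) (M : monomType).

Lemma malgUM (m n : M) : << mmul m n >> = << m >> * << n >> :> {malg K[M]}.
Proof. by rewrite malgM_def fgmulUU mulr1. Qed.

Lemma malg_expand (u : {malg K[M]}) : u = \sum_(m <- msupp u) u@_m *: << m >>.
Proof. by rewrite [LHS]monalgE; apply: eq_bigr => m _; rewrite malgUZ. Qed.

Lemma linear_ext (V : lmodType K) (f g : {malg K[M]} -> V) :
  linear f -> linear g -> (forall m, f << m >> = g << m >>) -> f =1 g.
Proof.
have linextE (h : {malg K[M]} -> V) : linear h -> h =1 linext (fun m => h << m >>).
  move=> lin u; rewrite [in LHS](malg_expand u) linear_fun_sum //.
  by apply: eq_bigr => m _; rewrite linear_funZ.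
move=> lf lg eqU u; rewrite linextE // [RHS]linextE //.
by apply: eq_bigr => m _; rewrite eqU.
Qed.

Section Extension.
Variables (A : lalgType K) (h : M -> A).
Hypothesis scaleAr : forall (c : K) (a b : A), c *: (a * b) = a * (c *: b).

(** A monoid algebra has the universal property that morphisms of monoids to
    the multiplicative monoid of [A] extend to morphisms of algebras. *)
Lemma linext_algebra_morphism :
    h mone = 1 -> (forall m n, h (mmul m n) = h m * h n) ->
  algebra_morphism (linext h).
Proof.
move=> h1 hM; split; first exact: linext_is_linear.
split=> [|u v]; first by rewrite linextU.
rewrite malgME [linext h u]/linext mulr_suml linear_sum /=.
apply: eq_bigr => m _; rewrite mulr_sumr linear_sum /=.
apply: eq_bigr => n _; rewrite malgUZ linearZ /= linextU hM.
by rewrite -scalerAl -scaleAr scalerA.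
Qed.

Lemma linext_antimultiplicative :
    (forall m n, h (mmul m n) = h n * h m) ->
  forall u v, linext h (u * v) = linext h v * linext h u.
Proof.
move=> hM u v; rewrite malgME linear_sum [linext h u]/linext mulr_sumr.
apply: eq_bigr => m _; rewrite [linext h v]/linext mulr_suml linear_sum /=.
apply: eq_bigr => n _; rewrite malgUZ linearZ /= linextU hM.
by rewrite -scalerAl -scaleAr scalerA mulrC.
Qed.
End Extension.
End MonoidAlgebra.

Section Composition.
Variable K : comNzRingType.

Lemma linear_compose (U V W : lmodType K) (g : V -> W) (f : U -> V) :
  linear g -> linear f -> linear (fun u => g (f u)).
Proof. by move=> lg lf c u v; rewrite lf lg. Qed.

Lemma algebra_morphism_compose (A B C : lalgType K) (g : B -> C) (f : A -> B) :
  algebra_morphism g -> algebra_morphism f ->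
  algebra_morphism (fun u => g (f u)).
Proof.
case=> lg [g1 gM] [lf [f1 fM]]; split; first exact: linear_compose.
by split=> [|u v]; rewrite ?f1 ?fM.
Qed.

(** The antipode of a Hopf algebra is of this kind, which is what allows it to
    be computed from its values on generators. *)
Definition algebra_antimorphism (A B : lalgType K) (f : A -> B) : Prop :=
  [/\ linear f, f 1 = 1 & forall u v, f (u * v) = f v * f u].

Lemma algebra_antimorphism_composel (A B C : lalgType K) (g : B -> C)
    (f : A -> B) :
  algebra_morphism g -> algebra_antimorphism f ->
  algebra_antimorphism (fun u => g (f u)).
Proof.
case=> lg [g1 gM] [lf f1 fM].
by split=> [||u v]; [exact: linear_compose | rewrite f1 | rewrite fM gM].
Qed.

Lemma algebra_antimorphism_composer (A B C : lalgType K) (g : B -> C)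
    (f : A -> B) :
  algebra_antimorphism g -> algebra_morphism f ->
  algebra_antimorphism (fun u => g (f u)).
Proof.
case=> lg g1 gM [lf [f1 fM]].
by split=> [||u v]; [exact: linear_compose | rewrite f1 | rewrite fM gM].
Qed.

Lemma tens11 (M N : monomType) : tens 1 1 = 1 :> {malg K[(M * N)%type]}.
Proof. exact: tensU. Qed.

Lemma algebra_morphism_tmap (M M' N N' : monomType)
    (f : {malg K[M]} -> {malg K[M']}) (g : {malg K[N]} -> {malg K[N']}) :
  algebra_morphism f -> algebra_morphism g -> algebra_morphism (tmap f g).
Proof.
case=> lf [f1 fM] [lg [g1 gM]]; apply: linext_algebra_morphism.
- exact: malg_scaleAr.
- by rewrite /= f1 g1 tens11.
- by move=> p q; rewrite /= !malgUM fM gM tensM.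
Qed.

Lemma algebra_morphism_tassoc (M N P : monomType) :
  algebra_morphism (@tassoc K M N P).
Proof.
apply: linext_algebra_morphism => [||p q]; [exact: malg_scaleAr | by [] |].
by rewrite -malgUM.
Qed.

Section Linear.
Variables (M M' N N' : monomType).
Variables (f : {malg K[M]} -> {malg K[M']}) (g : {malg K[N]} -> {malg K[N']}).
Hypotheses (lf : linear f) (lg : linear g).

Lemma tmap_tens u v : tmap f g (tens u v) = tens (f u) (g v).
Proof.
rewrite /tmap tlift_tens // => [w|w] c x y.
  by rewrite lf tensDl tensZl.
by rewrite lg tensDr tensZr.
Qed.
End Linear.

Lemma tens_suml (M N : monomType) I (r : seq I) (F : I -> {malg K[M]})
    (v : {malg K[N]}) :
  tens (\sum_(i <- r) F i) v = \sum_(i <- r) tens (F i) v.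
Proof.
apply: (linear_fun_sum (f := fun u => tens u v)) => c x y.
by rewrite tensDl tensZl.
Qed.

Lemma tens_sumr (M N : monomType) I (r : seq I) (F : I -> {malg K[N]})
    (u : {malg K[M]}) :
  tens u (\sum_(i <- r) F i) = \sum_(i <- r) tens u (F i).
Proof.
apply: (linear_fun_sum (f := fun v => tens u v)) => c x y.
by rewrite tensDr tensZr.
Qed.

Lemma tassoc_tensU (M N P : monomType) (m : M) (n : N) (p : P) :
  tassoc (tens (tens << m >> << n >>) << p >>) =
  tens << m >> (tens << n >> << p >>) :> {malg K[_]}.
Proof. by rewrite !tensU; apply: linextU. Qed.
End Composition.

Section TensorProductOfMaps.
Variables (K : comNzRingType) (M N P : monomType).
Variables (f : {malg K[M]} -> {malg K[P]}) (g : {malg K[N]} -> {malg K[P]}).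
Hypotheses (lf : linear f) (lg : linear g).
Local Notation fg := (tlift (fun u v => f u * g v)).

Lemma tlift_mul_tens u v : fg (tens u v) = f u * g v.
Proof.
rewrite tlift_tens // => w c x y; first by rewrite lf mulrDl scalerAl.
by rewrite lg mulrDr malg_scaleAr.
Qed.

(** [f] reverses products and [g] preserves them, so multiplying the argument
    on the right wraps the value: [f (p u) * g (q v) = f u * (f p * g q) * g v].
    This is the mechanism by which antipode identities pass to products. *)
Lemma tlift_mul_tensr u v z :
    (forall x y, f (x * y) = f y * f x) -> (forall x y, g (x * y) = g x * g y) ->
  fg (z * tens u v) = f u * fg z * g v.
Proof.
move=> fM gM; have linfg : linear fg by exact: linext_is_linear.
move: z; apply: linear_ext => [k y z|k y z|[m n]].
- by rewrite mulrDl -scalerAl linfg.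
- by rewrite linfg mulrDr mulrDl -malg_scaleAr -scalerAl.
by rewrite -tensU tensM !tlift_mul_tens fM gM !mulrA.
Qed.

Lemma tlift_mul_tensl u v z :
    (forall x y, f (x * y) = f x * f y) -> (forall x y, g (x * y) = g y * g x) ->
  fg (tens u v * z) = f u * fg z * g v.
Proof.
move=> fM gM; have linfg : linear fg by exact: linext_is_linear.
move: z; apply: linear_ext => [k y z|k y z|[m n]].
- by rewrite mulrDr -malg_scaleAr linfg.
- by rewrite linfg mulrDr mulrDl -malg_scaleAr -scalerAl.
by rewrite -tensU tensM !tlift_mul_tens fM gM !mulrA.
Qed.
End TensorProductOfMaps.

(** * Free algebras *)

Lemma fmonom_ind (I : choiceType) (P : {fmonom I} -> Prop) :
    P mone -> (forall i w, P w -> P (mmul (fmu i) w)) -> forall w, P w.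
Proof.
move=> P1 PS [s]; elim: s => [|i s IHs].
  by have -> : FMonom [::] = mone :> {fmonom I} by apply: val_inj; rewrite /= fm1.
have -> : FMonom (i :: s) = mmul (fmu i) (FMonom s) :> {fmonom I}.
  by apply: val_inj; rewrite /= fmM fmU.
exact: PS.
Qed.

Section Free.
Variables (K : comNzRingType) (X : choiceType) (x0 : X).
Local Notation T := {malg K[{fmonom (letter x0)}]}.
Local Notation gen := (gen K x0).

Definition gen_word (x : X) : {fmonom (letter x0)} :=
  if insub x is Some y then fmu y else mone.

Lemma gen_wordE x : gen x = << gen_word x >>.
Proof. by rewrite /gen /gen_word; case: insub. Qed.

Lemma malgU_fmu (y : letter x0) : << fmu y >> = gen (val y) :> T.
Proof. by rewrite /gen valK. Qed.

Lemma free_ext (A : lalgType K) (f g : T -> A) :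
  algebra_morphism f -> algebra_morphism g ->
  (forall x, f (gen x) = g (gen x)) -> f =1 g.
Proof.
move=> [lf [f1 fM]] [lg [g1 gM]] eq_gen; apply: linear_ext => // w.
elim/fmonom_ind: w => [|y w IHw]; first by rewrite f1 g1.
by rewrite malgUM fM gM IHw malgU_fmu eq_gen.
Qed.

Lemma free_ext_anti (A : lalgType K) (f g : T -> A) :
  algebra_antimorphism f -> algebra_antimorphism g ->
  (forall x, f (gen x) = g (gen x)) -> f =1 g.
Proof.
move=> [lf f1 fM] [lg g1 gM] eq_gen; apply: linear_ext => // w.
elim/fmonom_ind: w => [|y w IHw]; first exact: etrans f1 (esym g1).
by rewrite malgUM fM gM IHw malgU_fmu eq_gen.
Qed.

Lemma free_lift_gen1 (A : lalgType K) (f : X -> A) x :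
  f x0 = 1 -> free_lift f (gen x) = f x.
Proof.
move=> f1; have [->|ne] := eqVneq x x0; last exact: free_lift_gen.
by rewrite f1 gen0 /free_lift linextU fm1 big_nil.
Qed.

Definition anti_lift (s : X -> T) : T -> T :=
  linext (fun w : {fmonom (letter x0)} => \prod_(y <- rev w) s (val y)).

Lemma anti_lift_antimorphism s : algebra_antimorphism (anti_lift s).
Proof.
split; [exact: linext_is_linear | by rewrite /anti_lift linextU fm1 big_nil |].
apply: linext_antimultiplicative; first exact: malg_scaleAr.
by move=> m n; rewrite fmM rev_cat big_cat.
Qed.

Lemma anti_lift_gen s x : s x0 = 1 -> anti_lift s (gen x) = s x.
Proof.
move=> s1; have [->|ne] := eqVneq x x0; last first.
  by rewrite genE /anti_lift linextU fmU big_seq1.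
by rewrite gen0 s1; have [_ ->] := anti_lift_antimorphism s.
Qed.
End Free.

(** * Graded monoids with finitely many factorisations *)

(** [cuts x] lists the factorisations of [x], once each; it is the co-product
    dual to [mul]. Trivial degree 0 makes the resulting co-algebra connected,
    which is what gives it an antipode. *)
Record graded_monoid (X : choiceType) (x0 : X) (mul : X -> X -> X)
    (deg : X -> nat) (cuts : X -> seq (X * X)) : Prop := GradedMonoid {
  gmulA : associative mul;
  gmul1 : left_id x0 mul;
  gmulr1 : right_id x0 mul;
  degM : forall x y, deg (mul x y) = (deg x + deg y)%N;
  deg0_eq : forall x, deg x = 0%N -> x = x0;
  uniq_cuts : forall x, uniq (cuts x);
  mem_cuts : forall x p, (p \in cuts x) = (mul p.1 p.2 == x)
}.

Definition add_cuts (n : nat) : seq (nat * nat) :=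
  [seq (k, (n - k)%N) | k <- iota 0 n.+1].

Lemma add_graded_monoid : graded_monoid 0%N addn id add_cuts.
Proof.
split=> //; [exact: addnA | exact: addn0 | |].
- by move=> n; rewrite map_inj_uniq ?iota_uniq // => i j [].
- move=> n [i j]; apply/mapP/eqP => [[k]|<-].
    by rewrite mem_iota add0n ltnS /= => le_kn [-> ->]; rewrite subnKC.
  exists i; first by rewrite mem_iota /= add0n ltnS leq_addr.
  by rewrite /= addKn.
Qed.

Section GradedMonoid.
Variables (X : choiceType) (x0 : X) (mul : X -> X -> X) (deg : X -> nat).
Variable cuts : X -> seq (X * X).
Hypothesis gm : graded_monoid x0 mul deg cuts.

Lemma deg_unit : deg x0 = 0%N.
Proof. by apply/eqP; rewrite -(eqn_add2l (deg x0)) -(degM gm) (gmul1 gm) addn0. Qed.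

Lemma deg_cut_lt x p : p \in cuts x -> p.2 != x0 -> (deg p.1 < deg x)%N.
Proof.
rewrite (mem_cuts gm) => /eqP<- ne; rewrite (degM gm) -{1}[deg p.1]addn0.
by rewrite ltn_add2l lt0n; apply: contraNneq ne => /(deg0_eq gm)->.
Qed.

Lemma cuts_unit : cuts x0 = [:: (x0, x0)].
Proof.
apply: perm_small_eq => //; apply: uniq_perm => //; first exact: uniq_cuts gm x0.
case=> a c; rewrite (mem_cuts gm) inE -pair_eqE /=.
apply/eqP/andP => [eq0|[/eqP-> /eqP->]]; last by rewrite (gmul1 gm).
move/(congr1 deg)/eqP: eq0; rewrite (degM gm) deg_unit addn_eq0.
move=> /andP[/eqP a0 /eqP c0].
by rewrite (deg0_eq gm a0) (deg0_eq gm c0).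
Qed.

Lemma big_nested_perm (V : nmodType) (I J I' J' : Type) (L : eqType)
    (F : L -> V) (r : seq I) (t : I -> seq J) (h : I -> J -> L)
    (r' : seq I') (t' : I' -> seq J') (h' : I' -> J' -> L) :
    perm_eq [seq h i j | i <- r, j <- t i] [seq h' i j | i <- r', j <- t' i] ->
  \sum_(i <- r) \sum_(j <- t i) F (h i j) =
  \sum_(i <- r') \sum_(j <- t' i) F (h' i j).
Proof. by move=> peq; rewrite -!big_allpairs_dep; apply: perm_big. Qed.

Section Sums.
Variable V : nmodType.

Lemma cuts_sum_unitl (F : X * X -> V) x :
  (forall p, p.1 != x0 -> F p = 0) -> \sum_(p <- cuts x) F p = F (x0, x).
Proof.
move=> F0; rewrite (bigD1_seq (x0, x)) ?(uniq_cuts gm) //=; last first.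
  by rewrite (mem_cuts gm) /= (gmul1 gm).
rewrite big_seq_cond big1 ?addr0 // => -[a c]; rewrite (mem_cuts gm) /=.
case/andP=> /eqP<-; rewrite -pair_eqE /= => ne; apply: F0 => /=.
by apply: contraNneq ne => ->; rewrite (gmul1 gm) !eqxx.
Qed.

Lemma cuts_sum_unitr (F : X * X -> V) x :
  (forall p, p.2 != x0 -> F p = 0) -> \sum_(p <- cuts x) F p = F (x, x0).
Proof.
move=> F0; rewrite (bigD1_seq (x, x0)) ?(uniq_cuts gm) //=; last first.
  by rewrite (mem_cuts gm) /= (gmulr1 gm).
rewrite big_seq_cond big1 ?addr0 // => -[a c]; rewrite (mem_cuts gm) /=.
case/andP=> /eqP<-; rewrite -pair_eqE /= => ne; apply: F0 => /=.
by apply: contraNneq ne => ->; rewrite (gmulr1 gm) !eqxx.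
Qed.

(** Both sides run over the factorisations of [x] into three factors: this is
    the co-associativity dual to the associativity of [mul]. *)
Lemma cuts_sumA (F : X -> X -> X -> V) x :
  \sum_(p <- cuts x) \sum_(q <- cuts p.1) F q.1 q.2 p.2 =
  \sum_(p <- cuts x) \sum_(q <- cuts p.2) F p.1 q.1 q.2.
Proof.
pose G (t : X * X * X) := F t.1.1 t.1.2 t.2.
apply: (big_nested_perm (h := fun p q : X * X => (q.1, q.2, p.2))
  (h' := fun p q : X * X => (p.1, q.1, q.2)) G).
apply: uniq_perm.
- apply: allpairs_uniq_dep => [|p _|]; try exact: uniq_cuts gm _.
  move=> _ _ /allpairsPdep[[a c] [[u v] [_ + ->]]]
    /allpairsPdep[[a' c'] [[u' v'] [_ + ->]]] /=.
  by rewrite !(mem_cuts gm) /= => /eqP<- /eqP<- [-> -> ->].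
- apply: allpairs_uniq_dep => [|p _|]; try exact: uniq_cuts gm _.
  move=> _ _ /allpairsPdep[[a c] [[u v] [_ + ->]]]
    /allpairsPdep[[a' c'] [[u' v'] [_ + ->]]] /=.
  by rewrite !(mem_cuts gm) /= => /eqP<- /eqP<- [-> -> ->].
- move=> [[a c] d]; apply/allpairsPdep/allpairsPdep.
    case=> -[e f] [[u v] []]; rewrite !(mem_cuts gm) /= => /eqP<- /eqP<- [-> -> ->].
    by exists (u, mul v f), (v, f); rewrite !(mem_cuts gm) /= (gmulA gm) !eqxx.
  case=> -[e f] [[u v] []]; rewrite !(mem_cuts gm) /= => /eqP<- /eqP<- [-> -> ->].
  by exists (mul e u, v), (e, u); rewrite !(mem_cuts gm) /= (gmulA gm) !eqxx.
Qed.

(** Both sides run over the pairs of elements whose degrees add up to [n]: such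
    a pair is a factorisation of a unique element, its product, which has
    degree [n]. *)
Lemma cuts_sum_fibre (Y : nat -> seq X) (F : X -> X -> V) n :
  (forall n x, (x \in Y n) = (deg x == n)) -> (forall n, uniq (Y n)) ->
  \sum_(x <- Y n) \sum_(p <- cuts x) F p.1 p.2 =
  \sum_(k <- add_cuts n) \sum_(x <- Y k.1) \sum_(y <- Y k.2) F x y.
Proof.
move=> memY uniqY; pose G (p : X * X) := F p.1 p.2.
have sumYY k : \sum_(x <- Y k.1) \sum_(y <- Y k.2) F x y =
    \sum_(p <- [seq (x, y) | x <- Y k.1, y <- Y k.2]) G p.
  by rewrite big_allpairs_dep.
under [RHS]eq_bigr => k _ do rewrite sumYY.
have memYY k p : (p \in [seq (x, y) | x <- Y k.1, y <- Y k.2]) =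
    (deg p.1 == k.1) && (deg p.2 == k.2).
  case: p => x y /=; apply/allpairsP/andP => [[[u v] /= [+ + [-> ->]]]|[xk yk]].
    by rewrite !memY.
  by exists (x, y); rewrite /= !memY.
apply: (big_nested_perm (h := fun _ p => p) (h' := fun _ p => p) G).
apply: uniq_perm.
- apply: allpairs_uniq_dep => [|x _|]; [exact: uniqY | exact: uniq_cuts gm _ |].
  move=> _ _ /allpairsPdep[x [p [_ + ->]]] /allpairsPdep[y [q [_ + ->]]] /=.
  by rewrite !(mem_cuts gm) => /eqP<- /eqP<- /= ->.
- apply: allpairs_uniq_dep => [|k _|].
  + exact: uniq_cuts add_graded_monoid n.
  + by apply: allpairs_uniq => // -[x y] [x' y'] _ _ [-> ->].
  move=> _ _ /allpairsPdep[[i j] [p [_ + ->]]]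
    /allpairsPdep[[i' j'] [q [_ + ->]]] /=.
  by rewrite !memYY /= => /andP[/eqP<- /eqP<-] /andP[/eqP<- /eqP<-] ->.
- move=> [x y]; apply/allpairsPdep/allpairsPdep.
    case=> z [p []]; rewrite memY (mem_cuts gm) => /eqP<- /eqP<- <-.
    exists (deg x, deg y), (x, y); rewrite (mem_cuts add_graded_monoid) memYY /=.
    by rewrite (degM gm) !eqxx.
  case=> -[i j] [p []]; rewrite (mem_cuts add_graded_monoid) memYY /=.
  move=> /eqP<- /andP[/eqP<- /eqP<-] <-; exists (mul x y), (x, y).
  by rewrite memY (mem_cuts gm) /= (degM gm) !eqxx.
Qed.
End Sums.

(** * Convolution of functions on a graded monoid *)

Section Conv.
Variable A : nzRingType.
Implicit Types f g h : X -> A.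

Definition conv f g x : A := \sum_(p <- cuts x) f p.1 * g p.2.
Definition conv_unit x : A := (x == x0)%:R.

Lemma convA f g h : conv f (conv g h) =1 conv (conv f g) h.
Proof.
move=> x; rewrite /conv; under eq_bigr => p _ do rewrite mulr_sumr.
under [RHS]eq_bigr => p _ do rewrite mulr_suml.
rewrite (cuts_sumA (fun a c d => f a * g c * h d)).
by apply: eq_bigr => p _; apply: eq_bigr => q _; rewrite mulrA.
Qed.

Lemma conv1f f : conv conv_unit f =1 f.
Proof.
move=> x; rewrite /conv cuts_sum_unitl /conv_unit /= ?eqxx ?mul1r //.
by move=> p /negPf->; rewrite mul0r.
Qed.

Lemma convf1 f : conv f conv_unit =1 f.
Proof.
move=> x; rewrite /conv cuts_sum_unitr /conv_unit /= ?eqxx ?mulr1 //.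
by move=> p /negPf->; rewrite mulr0.
Qed.

Lemma eq_conv f f' g g' : f =1 f' -> g =1 g' -> conv f g =1 conv f' g'.
Proof. by move=> ff gg x; apply: eq_bigr => p _; rewrite ff gg. Qed.

Lemma conv_inv_unique g f h :
  conv f g =1 conv_unit -> conv g h =1 conv_unit -> f =1 h.
Proof.
move=> fg gh x; rewrite -convf1 -(eq_conv (frefl f) gh) convA.
by rewrite (eq_conv fg (frefl h)) conv1f.
Qed.

(** The equation [conv f g = conv_unit], with [g x0 = 1], expresses [f x] by the
    values of [f] at proper left factors of [x], which have smaller degree. The
    argument [n] bounds the depth of this recursion; any [n > deg x] gives the
    same value. *)
Fixpoint conv_inv_rec g n x : A :=
  if n is n'.+1
  then conv_unit x - \sum_(p <- cuts x | p.2 != x0) conv_inv_rec g n' p.1 * g p.2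
  else 0.
Definition conv_inv g x := conv_inv_rec g (deg x).+1 x.

Lemma conv_inv_recE g n x : (deg x < n)%N -> conv_inv_rec g n x = conv_inv g x.
Proof.
rewrite /conv_inv; have [k] := ubnP (deg x); elim: k => // k IHk in n x *.
case: n => // n ltk ltn; rewrite [LHS]/= [RHS]/=; congr (_ - _).
rewrite big_seq_cond [RHS]big_seq_cond; apply: eq_bigr => p /andP[cut_p ne].
have lt_px := deg_cut_lt cut_p ne; have lt_pk := leq_trans lt_px ltk.
by congr (_ * _); rewrite IHk ?(leq_trans lt_px) // [RHS]IHk.
Qed.

Lemma conv_inv_left g : g x0 = 1 -> conv (conv_inv g) g =1 conv_unit.
Proof.
move=> g1 x; rewrite /conv (bigID (fun p => p.2 == x0)) /= big_mkcond /=.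
rewrite cuts_sum_unitr /= ?eqxx => [|p /negPf-> //].
rewrite g1 mulr1 {1}/conv_inv /=.
suff -> : \sum_(p <- cuts x | p.2 != x0) conv_inv_rec g (deg x) p.1 * g p.2
  = \sum_(p <- cuts x | p.2 != x0) conv_inv g p.1 * g p.2 by rewrite subrK.
rewrite big_seq_cond [RHS]big_seq_cond; apply: eq_bigr => p /andP[cut_p ne].
by rewrite conv_inv_recE // deg_cut_lt.
Qed.

Lemma conv_inv1 g : g x0 = 1 -> conv_inv g x0 = 1.
Proof.
move=> g1; have := conv_inv_left g1 x0.
by rewrite /conv cuts_unit big_seq1 /= g1 mulr1 /conv_unit eqxx.
Qed.

(** A left inverse [f] of [g] has itself a left inverse, which by associativity
    is [g]. *)
Lemma conv_inv_right g : g x0 = 1 -> conv g (conv_inv g) =1 conv_unit.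
Proof.
move=> g1; have f1 := conv_inv1 g1.
have eq_g := conv_inv_unique (conv_inv_left f1) (conv_inv_left g1).
by move=> x; rewrite -(conv_inv_left f1); apply: eq_conv.
Qed.
End Conv.
End GradedMonoid.

(** * Convolution inverses on a bialgebra *)

Section ConvolutionInverse.
Variables (K : comNzRingType) (M : monomType) (H : costructure K M).
Local Notation T := {malg K[M]}.

(** On letters whose co-product is a sum of tensors of letters, convolution of
    linear maps is convolution of their restrictions. *)
Lemma convolution_gen (X : choiceType) (cuts : X -> seq (X * X)) (g : X -> T)
    (f f' : T -> T) x :
    linear f -> linear f' ->
    (forall x, comul H (g x) = \sum_(p <- cuts x) tens (g p.1) (g p.2)) ->
  convolution H f f' (g x) = conv cuts (fun y => f (g y)) (fun y => f' (g y)) x.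
Proof.
move=> lf lf' comul_g; rewrite /convolution comul_g linear_fun_sum; last first.
  exact: linext_is_linear.
by apply: eq_bigr => p _; rewrite tlift_mul_tens.
Qed.

Section Antipode.
Variable S : T -> T.
Hypotheses (alg_comul : algebra_morphism (comul H)).
Hypotheses (alg_counit : algebra_morphism (counit H)).
Hypothesis (anti_S : algebra_antimorphism S).

Lemma convolution_left1 : convolution H S id 1 = (counit H 1 : K) *: 1.
Proof.
have [lS S1 SM] := anti_S.
have [_ [comul1 _]] := alg_comul; have [_ [eps1 _]] := alg_counit.
by rewrite /convolution comul1 eps1 -tens11 tlift_mul_tens // S1 mulr1 scale1r.
Qed.

Lemma convolution_right1 : convolution H id S 1 = (counit H 1 : K) *: 1.
Proof.
have [lS S1 SM] := anti_S.
have [_ [comul1 _]] := alg_comul; have [_ [eps1 _]] := alg_counit.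
by rewrite /convolution comul1 eps1 -tens11 tlift_mul_tens // S1 mulr1 scale1r.
Qed.

(** In Sweedler notation,
    [S (x1 y1) x2 y2 = S y1 (S x1 x2) y2 = counit x (S y1 y2)]. *)
Lemma convolution_leftM x y :
    convolution H S id x = (counit H x : K) *: 1 ->
    convolution H S id y = (counit H y : K) *: 1 ->
  convolution H S id (x * y) = (counit H (x * y) : K) *: 1.
Proof.
have [lS S1 SM] := anti_S.
have [_ [_ comulM]] := alg_comul; have [_ [_ epsM]] := alg_counit.
have linSid : linear (tlift (fun u v => S u * id v)) by exact: linext_is_linear.
rewrite /convolution epsM comulM -scalerA => Sx <-.
move: (comul H y).
apply: linear_ext => [c u v|c u v|[m n]].
- by rewrite mulrDr -malg_scaleAr linSid.
- by rewrite linSid scalerDr scalerA mulrC -scalerA.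
rewrite -tensU tlift_mul_tensr // Sx tlift_mul_tens //.
by rewrite -malg_scaleAr -scalerAl mulr1.
Qed.

(** Symmetrically,
    [x1 y1 S (x2 y2) = x1 (y1 S y2) S x2 = counit y (x1 S x2)]. *)
Lemma convolution_rightM x y :
    convolution H id S x = (counit H x : K) *: 1 ->
    convolution H id S y = (counit H y : K) *: 1 ->
  convolution H id S (x * y) = (counit H (x * y) : K) *: 1.
Proof.
have [lS S1 SM] := anti_S.
have [_ [_ comulM]] := alg_comul; have [_ [_ epsM]] := alg_counit.
have linidS : linear (tlift (fun u v => id u * S v)) by exact: linext_is_linear.
rewrite /convolution epsM comulM [_ * _ : K^o]mulrC -scalerA => <- Sy.
move: (comul H x).
apply: linear_ext => [c u v|c u v|[m n]].
- by rewrite mulrDl -scalerAl linidS.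
- by rewrite linidS scalerDr scalerA mulrC -scalerA.
rewrite -tensU tlift_mul_tensl // Sy tlift_mul_tens //.
by rewrite -malg_scaleAr -scalerAl mulr1.
Qed.
End Antipode.
End ConvolutionInverse.

(** The co-product of [f u] is the image under [f] (x) [f] of that of [u], hence
    a sum of tensors of elements of the image. *)
Lemma hopf_morphism_image (K : comNzRingType) (M N : monomType)
    (H : costructure K M) (S : {malg K[M]} -> {malg K[M]})
    (H' : costructure K N) (S' : {malg K[N]} -> {malg K[N]})
    (f : {malg K[M]} -> {malg K[N]}) :
  hopf_morphism H S H' S' f ->
  hopf_subalgebra H' S' (fun y => exists x, y = f x).
Proof.
case=> -[lf [f1 fM]] [_ fcomul _] fS.
split=> [|c _ _ [u ->] [v ->]|_ [u ->]|_ [u ->]].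
- by split=> [|_ _ [u ->] [v ->]]; [exists 1 | exists (u * v)].
- by exists (c *: u + v); rewrite lf.
- rewrite fcomul; set z := comul H u.
  exists [seq (z@_p *: f << p.1 >>, f << p.2 >>) | p <- msupp z].
  split=> [_ /mapP[p _ ->] /=|].
    by split; [exists (z@_p *: << p.1 >>); rewrite linear_funZ | exists << p.2 >>].
  by rewrite big_map; apply: eq_bigr => p _; rewrite tensZl.
- by exists (S u); rewrite fS.
Qed.

Section ConvolutionMorphism.
Variables (K : comNzRingType) (A B : lalgType K) (X : choiceType) (x0 : X).
Variables (cuts : X -> seq (X * X)) (f : A -> B).
Hypothesis alg_f : algebra_morphism f.

Lemma conv_morphism (g h : X -> A) x :
  f (conv cuts g h x) = conv cuts (fun y => f (g y)) (fun y => f (h y)) x.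
Proof.
have [lf [_ fM]] := alg_f; rewrite /conv linear_fun_sum //.
by apply: eq_bigr => p _; rewrite fM.
Qed.

Lemma conv_unit_morphism x : f (conv_unit x0 A x) = conv_unit x0 B x.
Proof.
have [lf [f1 _]] := alg_f; rewrite /conv_unit -!scaler_nat linear_funZ //.
by rewrite f1.
Qed.
End ConvolutionMorphism.

Section ScaledConvolutionInverse.
Variables (K : comNzRingType) (A : lalgType K) (X : choiceType) (x0 : X).
Variables (mul : X -> X -> X) (deg : X -> nat) (cuts : X -> seq (X * X)).
Hypothesis gm : graded_monoid x0 mul deg cuts.
Variable g : X -> A.
Hypothesis g1 : g x0 = 1.

Lemma conv_inv_left_scale x :
  conv cuts (conv_inv x0 deg cuts g) g x = ((x == x0)%:R : K) *: 1.
Proof. by rewrite (conv_inv_left gm) // scaler_nat. Qed.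

Lemma conv_inv_right_scale x :
  conv cuts g (conv_inv x0 deg cuts g) x = ((x == x0)%:R : K) *: 1.
Proof. by rewrite (conv_inv_right gm) // scaler_nat. Qed.
End ScaledConvolutionInverse.

(** * The Hopf algebra of a graded monoid *)

Definition cut_costructure (K : comNzRingType) (X : choiceType) (x0 : X)
    (cuts : X -> seq (X * X)) : costructure K {fmonom (letter x0)} := {|
  comul := free_lift (fun x =>
    \sum_(p <- cuts x) tens (gen K x0 p.1) (gen K x0 p.2));
  counit := free_lift (fun=> 0 : K^o)
|}.

Section CutHopf.
Variables (K : comNzRingType) (X : choiceType) (x0 : X).
Variables (mul : X -> X -> X) (deg : X -> nat) (cuts : X -> seq (X * X)).
Hypothesis gm : graded_monoid x0 mul deg cuts.
Local Notation T := {malg K[{fmonom (letter x0)}]}.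
Local Notation gen := (gen K x0).
Local Notation H := (cut_costructure K x0 cuts).

Lemma comul_algebra_morphism : algebra_morphism (comul H).
Proof. by apply: free_lift_algebra_morphism; apply: malg_scaleAr. Qed.

Lemma counit_algebra_morphism : algebra_morphism (counit H).
Proof. by apply: free_lift_algebra_morphism => c a d; apply: mulrCA. Qed.

Lemma comul_gen x :
  comul H (gen x) = \sum_(p <- cuts x) tens (gen p.1) (gen p.2).
Proof.
apply: (free_lift_gen1 (f := fun x => \sum_(p <- cuts x) tens (gen p.1) (gen p.2))).
by rewrite (cuts_unit gm) big_seq1 /= gen0 tens11.
Qed.

Lemma counit_gen x : counit H (gen x) = (x == x0)%:R.
Proof.
have [->|ne] := eqVneq x x0; last exact: free_lift_gen.
by rewrite gen0; have [_ []] := counit_algebra_morphism.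
Qed.

Lemma cut_coassoc u :
  tassoc (tmap (comul H) id (comul H u)) = tmap id (comul H) (comul H u).
Proof.
have alg_comul := comul_algebra_morphism; have [lin_comul _] := alg_comul.
have alg_id : algebra_morphism (@id T) by [].
have alg_l := algebra_morphism_tmap alg_comul alg_id.
have alg_r := algebra_morphism_tmap alg_id alg_comul.
have alg_a := @algebra_morphism_tassoc K {fmonom (letter x0)}
  {fmonom (letter x0)} {fmonom (letter x0)}.
move: u; apply: free_ext => [||x].
- exact: (algebra_morphism_compose alg_a (algebra_morphism_compose alg_l alg_comul)).
- exact: (algebra_morphism_compose alg_r alg_comul).
rewrite comul_gen (linear_fun_sum alg_l.1) (linear_fun_sum alg_a.1)
  (linear_fun_sum alg_r.1).
transitivity (\sum_(p <- cuts x) \sum_(q <- cuts p.1)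
    tens (gen q.1) (tens (gen q.2) (gen p.2))).
  apply: eq_bigr => p _; rewrite tmap_tens // comul_gen tens_suml.
  rewrite linear_fun_sum; last exact: alg_a.1.
  by apply: eq_bigr => q _; rewrite !gen_wordE tassoc_tensU.
rewrite (cuts_sumA gm (fun a c d => tens (gen a) (tens (gen c) (gen d)))).
apply: eq_bigr => p _; by rewrite tmap_tens // comul_gen tens_sumr.
Qed.

Lemma cut_counitl u : tlift (fun a c => (counit H a : K) *: c) (comul H u) = u.
Proof.
have alg_eps := counit_algebra_morphism; have [lin_eps [eps1 epsM]] := alg_eps.
have alg_l : algebra_morphism
    (tlift (fun (a : T) (c : T) => (counit H a : K) *: c)).
  apply: linext_algebra_morphism => [||p q]; first exact: malg_scaleAr.
    by rewrite [counit H _]eps1 scale1r.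
  by rewrite malgUM [counit H _]epsM malgUM -scalerAl -malg_scaleAr scalerA.
move: u; apply: free_ext => [|//|x].
  exact: (algebra_morphism_compose alg_l comul_algebra_morphism).
rewrite comul_gen linear_fun_sum; last exact: alg_l.1.
rewrite (eq_bigr (fun p => (counit H (gen p.1) : K) *: gen p.2)) => [|p _].
  rewrite (cuts_sum_unitl gm) => [|p /negPf ne].
    by rewrite counit_gen eqxx scale1r.
  by rewrite counit_gen ne scale0r.
by rewrite !gen_wordE tensU /tlift linextU.
Qed.

Lemma cut_counitr u : tlift (fun a c => (counit H c : K) *: a) (comul H u) = u.
Proof.
have alg_eps := counit_algebra_morphism; have [lin_eps [eps1 epsM]] := alg_eps.
have alg_r : algebra_morphism
    (tlift (fun (a : T) (c : T) => (counit H c : K) *: a)).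
  apply: linext_algebra_morphism => [||p q]; first exact: malg_scaleAr.
    by rewrite [counit H _]eps1 scale1r.
  by rewrite malgUM [counit H _]epsM malgUM -scalerAl -malg_scaleAr scalerA.
move: u; apply: free_ext => [|//|x].
  exact: (algebra_morphism_compose alg_r comul_algebra_morphism).
rewrite comul_gen linear_fun_sum; last exact: alg_r.1.
rewrite (eq_bigr (fun p => (counit H (gen p.2) : K) *: gen p.1)) => [|p _].
  rewrite (cuts_sum_unitr gm) => [|p /negPf ne].
    by rewrite counit_gen eqxx scale1r.
  by rewrite counit_gen ne scale0r.
by rewrite !gen_wordE tensU /tlift linextU.
Qed.

Lemma cut_bialgebra : is_bialgebra H.
Proof.
split; last exact: counit_algebra_morphism; last exact: comul_algebra_morphism.
split; [exact: comul_algebra_morphism.1 | exact: counit_algebra_morphism.1 | | |].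
- exact: cut_coassoc.
- exact: cut_counitl.
- exact: cut_counitr.
Qed.

(** The antipode is the convolution inverse of the identity, and its restriction
    to letters that of the inclusion of letters. *)
Definition letter_antipode : X -> T := conv_inv x0 deg cuts gen.
Definition antipode : T -> T := anti_lift letter_antipode.

Lemma letter_antipode1 : letter_antipode x0 = 1.
Proof. by apply: (conv_inv1 gm); rewrite gen0. Qed.

Lemma antipode_gen x : antipode (gen x) = letter_antipode x.
Proof. by apply: anti_lift_gen; exact: letter_antipode1. Qed.

Lemma antipode_antimorphism : algebra_antimorphism antipode.
Proof. exact: anti_lift_antimorphism. Qed.

Lemma cut_antipode : is_antipode H antipode.
Proof.
have alg_comul := comul_algebra_morphism; have alg_eps := counit_algebra_morphism.
have anti_S := antipode_antimorphism; have [lS S1 SM] := anti_S.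
have lid : linear (@id T) by [].
have g1 : gen x0 = 1 by exact: gen0.
have SL x : convolution H antipode id (gen x) = (counit H (gen x) : K) *: 1.
  rewrite (convolution_gen x lS lid comul_gen) counit_gen.
  rewrite -(conv_inv_left_scale gm g1); apply: eq_bigr => p _; congr (_ * _).
  exact: antipode_gen.
have SR x : convolution H id antipode (gen x) = (counit H (gen x) : K) *: 1.
  rewrite (convolution_gen x lid lS comul_gen) counit_gen.
  rewrite -(conv_inv_right_scale gm g1); apply: eq_bigr => p _; congr (_ * _).
  exact: antipode_gen.
have lin_eps1 : linear (fun u : T => (counit H u : K) *: (1 : T)).
  by move=> c u v; rewrite alg_eps.1 scalerDl scalerA.
split=> //.
- apply: linear_ext => [||w].
  + by apply: linear_compose alg_comul.1; apply: linext_is_linear.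
  + exact: lin_eps1.
  elim/fmonom_ind: w => [|y w IHw].
    exact: (convolution_left1 alg_comul alg_eps anti_S).
  rewrite malgUM malgU_fmu.
  exact: (convolution_leftM alg_comul alg_eps anti_S (SL _) IHw).
- apply: linear_ext => [||w].
  + by apply: linear_compose alg_comul.1; apply: linext_is_linear.
  + exact: lin_eps1.
  elim/fmonom_ind: w => [|y w IHw].
    exact: (convolution_right1 alg_comul alg_eps anti_S).
  rewrite malgUM malgU_fmu.
  exact: (convolution_rightM alg_comul alg_eps anti_S (SR _) IHw).
Qed.

Lemma cut_hopf_algebra : is_hopf_algebra H antipode.
Proof. by split; [exact: cut_bialgebra | exact: cut_antipode]. Qed.
End CutHopf.

(** * Sums over the fibres of the degree *)

Section FibreMap.
Variables (K : comNzRingType) (X : choiceType) (x0 : X).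
Variables (mul : X -> X -> X) (deg : X -> nat) (cuts : X -> seq (X * X)).
Hypothesis gm : graded_monoid x0 mul deg cuts.
Variables (Y : nat -> seq X) (sec : nat -> X).
Hypothesis memY : forall n x, (x \in Y n) = (deg x == n).
Hypothesis uniqY : forall n, uniq (Y n).
Hypothesis deg_sec : forall n, deg (sec n) = n.
Local Notation T := {malg K[{fmonom (letter x0)}]}.
Local Notation B := {malg K[{fmonom (letter 0%N)}]}.
Local Notation gen := (gen K x0).
Local Notation b := (Defs.gen K 0%N).
Local Notation H := (cut_costructure K x0 cuts).
Local Notation Hn := (cut_costructure K 0%N add_cuts).
Local Notation S := (@antipode K X x0 deg cuts).
Local Notation Sn := (@antipode K nat 0%N id add_cuts).

Definition fibre_sum (n : nat) : T := \sum_(x <- Y n) gen x.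
Definition fibre_map : B -> T := free_lift fibre_sum.

Lemma fibre_map_algebra_morphism : algebra_morphism fibre_map.
Proof. by apply: free_lift_algebra_morphism; apply: malg_scaleAr. Qed.

Lemma fibre0 : Y 0 = [:: x0].
Proof.
apply: perm_small_eq => //; apply: uniq_perm => // x.
rewrite memY inE; apply/eqP/eqP => [/(deg0_eq gm)|->] //; exact: deg_unit gm.
Qed.

(** The co-unit is compatible with the degree because the unit is the only
    element of degree 0. *)
Lemma sum_fibre_unit (A : nzRingType) n :
  \sum_(x <- Y n) conv_unit x0 A x = conv_unit 0%N A n.
Proof.
rewrite /conv_unit; have [->|n0] := eqVneq n 0%N.
  by rewrite fibre0 big_seq1 eqxx.
rewrite big_seq big1 // => x; rewrite memY => /eqP degx.
by case: eqP => // eqx; move: n0; rewrite -degx eqx (deg_unit gm) eqxx.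
Qed.

Lemma fibre_map_gen n : fibre_map (b n) = fibre_sum n.
Proof. by apply: free_lift_gen1; rewrite /fibre_sum fibre0 big_seq1 gen0. Qed.

(** The elements [sec n], one in each degree, define a retraction. *)
Lemma fibre_map_inj : injective fibre_map.
Proof.
pose r : T -> B := free_lift (fun x => if sec (deg x) == x then b (deg x) else 0).
have alg_r : algebra_morphism r.
  by apply: free_lift_algebra_morphism; apply: malg_scaleAr.
have sec0 : sec 0 = x0 by apply: (deg0_eq gm); rewrite deg_sec.
apply: (can_inj (g := r)); apply: free_ext => [|//|n].
  exact: (algebra_morphism_compose alg_r fibre_map_algebra_morphism).
rewrite fibre_map_gen /fibre_sum (linear_fun_sum alg_r.1).
have r_gen x : r (gen x) = if sec (deg x) == x then b (deg x) else 0.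
  by apply: free_lift_gen1; rewrite (deg_unit gm) sec0 eqxx gen0.
rewrite (bigD1_seq (sec n)) ?memY ?deg_sec //= r_gen deg_sec eqxx.
rewrite big_seq_cond big1 ?addr0 // => x; rewrite memY => /andP[/eqP degx ne].
by rewrite r_gen degx eq_sym (negPf ne).
Qed.

Lemma fibre_map_comul u :
  comul H (fibre_map u) = tmap fibre_map fibre_map (comul Hn u).
Proof.
have alg_f := fibre_map_algebra_morphism; have [lin_f _] := alg_f.
have alg_comul := comul_algebra_morphism K x0 cuts.
have alg_comuln := comul_algebra_morphism K 0%N add_cuts.
have alg_ff := algebra_morphism_tmap alg_f alg_f.
move: u; apply: free_ext => [||n].
- exact: (algebra_morphism_compose alg_comul alg_f).
- exact: (algebra_morphism_compose alg_ff alg_comuln).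
rewrite fibre_map_gen (linear_fun_sum alg_comul.1).
under eq_bigr => x _ do rewrite (comul_gen K gm).
rewrite (cuts_sum_fibre gm (fun x y => tens (gen x) (gen y)) n memY uniqY).
rewrite (comul_gen K add_graded_monoid) (linear_fun_sum alg_ff.1).
apply: eq_bigr => k _; rewrite tmap_tens // !fibre_map_gen tens_suml.
by apply: eq_bigr => x _; rewrite tens_sumr.
Qed.

Lemma fibre_map_counit u : counit H (fibre_map u) = counit Hn u.
Proof.
have alg_f := fibre_map_algebra_morphism.
have alg_counit := counit_algebra_morphism K x0 cuts.
move: u; apply: free_ext => [||n].
- exact: (algebra_morphism_compose alg_counit alg_f).
- exact: counit_algebra_morphism.
rewrite fibre_map_gen counit_gen (linear_fun_sum alg_counit.1).
under eq_bigr => x _ do rewrite counit_gen.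
exact: (sum_fibre_unit K).
Qed.

Lemma fibre_map_coalgebra_morphism : coalgebra_morphism Hn H fibre_map.
Proof.
split; [exact: fibre_map_algebra_morphism.1 | exact: fibre_map_comul |].
exact: fibre_map_counit.
Qed.

(** On letters both sides are convolution inverses of [fibre_sum]: the left
    one because [fibre_map] is multiplicative, the right one because the sum
    over fibres turns convolution on [X] into convolution on degrees. *)
Lemma fibre_map_antipode u : fibre_map (Sn u) = S (fibre_map u).
Proof.
have alg_f := fibre_map_algebra_morphism.
have anti_S := antipode_antimorphism K x0 deg cuts.
have anti_Sn := antipode_antimorphism K 0%N id add_cuts.
have [lS _ _] := anti_S.
have b1 : b 0 = 1 by exact: gen0.
have g1 : gen x0 = 1 by exact: gen0.
have SL : conv add_cuts (fun n => S (fibre_sum n)) fibre_sum =1 conv_unit 0%N T.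
  move=> n; rewrite -sum_fibre_unit.
  transitivity (\sum_(x <- Y n) conv cuts (letter_antipode K x0 deg cuts) gen x).
    rewrite [RHS](cuts_sum_fibre gm (fun x y => _ x * gen y) n memY uniqY).
    apply: eq_bigr => k _; rewrite (linear_fun_sum lS) mulr_suml.
    apply: eq_bigr => x _; rewrite mulr_sumr; apply: eq_bigr => y _.
    by rewrite (antipode_gen K gm).
  by apply: eq_bigr => x _; rewrite (conv_inv_left gm g1).
have SR : conv add_cuts fibre_sum (fun n => fibre_map (Sn (b n)))
    =1 conv_unit 0%N T.
  move=> n; rewrite -(conv_unit_morphism _ alg_f).
  rewrite -(conv_inv_right add_graded_monoid b1) (conv_morphism _ alg_f).
  apply: eq_bigr => k _.
  by rewrite (antipode_gen K add_graded_monoid) fibre_map_gen.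
move: u; apply: free_ext_anti => [||n].
- exact: algebra_antimorphism_composel alg_f anti_Sn.
- exact: algebra_antimorphism_composer anti_S alg_f.
by rewrite fibre_map_gen (conv_inv_unique add_graded_monoid SL SR).
Qed.

(** The statement for an arbitrary graded monoid whose degree is surjective
    with finite fibres. *)
Theorem fibre_map_hopf :
  [/\ injective fibre_map, coalgebra_morphism Hn H fibre_map
    & hopf_subalgebra_via Hn H fibre_map].
Proof.
have coalg := fibre_map_coalgebra_morphism; have inj := fibre_map_inj.
have hopf : hopf_morphism Hn Sn H S fibre_map.
  by split; [exact: fibre_map_algebra_morphism | | exact: fibre_map_antipode].
split=> //; exists Sn, S; split=> //.
- exact: cut_hopf_algebra add_graded_monoid.
- exact: cut_hopf_algebra gm.
- exact: hopf_morphism_image hopf.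
Qed.
End FibreMap.

(** * Planar binary trees *)

Fixpoint under (t s : pbtree) : pbtree :=
  if t is node r t' then node r (under t' s) else s.

Fixpoint over (t s : pbtree) : pbtree :=
  if s is node s' r then node (over t s') r else t.

(** A tree is a right spine with subtrees grafted on its left, and [under]
    concatenates spines; [cuts_e] lists the ways to split a spine in two. *)
Lemma under_graded_monoid : graded_monoid leaf under internal cuts_e.
Proof.
split=> //.
- by elim=> //= r _ t IHt u v; rewrite IHt.
- by elim=> //= r _ t ->.
- by elim=> //= r _ t IHt s; rewrite IHt addnA.
- by case.
- elim=> //= r _ s IHs; apply/andP; split; first by apply/mapP => -[].
  by rewrite map_inj_uniq // => -[a c] [a' c'] [-> ->].
- elim=> [|r _ s IHs] [[|r' a] c] //=.
  + by rewrite !inE.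
  + by rewrite in_cons -pair_eqE /= orbC; case: mapP => [[]|_].
  rewrite in_cons /=; apply/mapP/eqP => [[[a' c'] + [-> -> ->]]|[-> eqs]].
    by rewrite IHs => /eqP /= ->.
  by exists (a, c); rewrite // IHs /= eqs.
Qed.

(** The mirror image: [over] concatenates left spines. *)
Lemma over_graded_monoid : graded_monoid leaf over internal cuts_gamma.
Proof.
split=> //.
- by move=> t s; elim=> //= u ->.
- by elim=> //= t -> s.
- by move=> t; elim=> [|s IHs r _] /=; rewrite ?addn0 // IHs addnS addnA.
- by case.
- elim=> //= r IHr s _; apply/andP; split; first by apply/mapP => -[].
  by rewrite map_inj_uniq // => -[a c] [a' c'] [-> ->].
- elim=> [|r IHr s _] [a [|c s']] //=; rewrite ?inE -?pair_eqE /= ?andbF ?andbT //.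
    by rewrite orbC; case: mapP => [[]|].
  apply/mapP/eqP => [[[a' c'] + [-> -> ->]]|[eqr ->]].
    by rewrite IHr => /eqP /= ->.
  by exists (a, c); rewrite // IHr /= eqr.
Qed.

Definition comb (n : nat) : pbtree := iter n (node leaf) leaf.

Lemma internal_comb n : internal (comb n) = n.
Proof. by elim: n => //= n ->. Qed.

(** The factorisations of [n] in the additive monoid are the pairs [(k, n - k)],
    so the general construction yields the given co-product. *)
Lemma Hinv_cut_costructure (K : comNzRingType) :
  Hinv K = cut_costructure K 0%N add_cuts.
Proof.
have eq_h : (fun n => \sum_(k < n.+1) tens (b K k) (b K (n - k))) =
    (fun n => \sum_(p <- add_cuts n) tens (gen K 0%N p.1) (gen K 0%N p.2)).
  apply/funext => n; rewrite big_map -[iota 0 n.+1]/(index_iota 0 n.+1).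
  by rewrite big_mkord.
exact: (congr1 (fun h =>
  Costructure (free_lift (A := {malg K[(Inv * Inv)%type]}) h)
    (free_lift (fun=> 0 : K^o))) eq_h).
Qed.

Theorem proposition4p2 (R : realType) :
  [/\ injective (@tree_map R[i]),
      coalgebra_morphism (Hinv R[i]) (He R[i]) (@tree_map R[i])
    & hopf_subalgebra_via (Hinv R[i]) (He R[i]) (@tree_map R[i])]
  /\
  [/\ injective (@tree_map R[i]),
      coalgebra_morphism (Hinv R[i]) (Hgamma R[i]) (@tree_map R[i])
    & hopf_subalgebra_via (Hinv R[i]) (Hgamma R[i]) (@tree_map R[i])].
Proof.
rewrite Hinv_cut_costructure; split.
- exact: (fibre_map_hopf R[i] under_graded_monoid mem_Y uniq_Y internal_comb).
- exact: (fibre_map_hopf R[i] over_graded_monoid mem_Y uniq_Y internal_comb).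
Qed.
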